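(* Let $V_n$ be a set of $n$ vertices, $N\geq1$, let $g_x:\mathbb{N}\to\mathbb{R}$ ($x\in V_n$) satisfy $g_x(0)=0$ and $\min_{x}\inf_{k\geq1}g_x(k)\geq1$, let $H:\mathbb{N}^{V_n}\to\mathbb{R}$ be any function, and let $\mathcal{L}$, $\nu_{V_n}^N$, $c_x$, $r_{x,y}$, $\mathcal{M}$, $\varepsilon_x$ be as in the context. Assume there exists $\delta>0$ such that $\mathcal{M}\geq\delta$ pointwise as quadratic forms, i.e. for every $\eta\in S_N$ and every vector $w=(w_x)_{x\in V_n}$ with $w_x=0$ whenever $\eta_x=0$, $$\sum_{x,y\in V_n}w_x\,\mathcal{M}_{x,y}(\eta)\,w_y\geq\delta\sum_{x\in V_n}w_x^2 .$$ Then $\mathrm{gap}(\mathcal{L})\geq\delta$. In particular (without assuming the existence of $\delta$), $$\mathrm{gap}(\mathcal{L})\geq\min_{x\in V_n}\;\min_{\eta\in S_N:\,\eta_x>0}\;n\,c_x(\eta)\left(1-\frac{c_x(\eta^{x-})}{c_x(\eta)}-\varepsilon_x(\eta)\right).$$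
   Context: $\mathbb{N}=\{0,1,2,\dots\}$. $S_N:=\{\eta\in\mathbb{N}^{V_n}:\sum_{x}\eta_x=N\}$. For $x,z\in V_n$, $\eta^{xz}$ is the configuration in which a particle (if there is one at $x$) is moved from $x$ to $z$; $\eta^{xz}=\eta$ if $\eta_x=0$ or $x=z$. $\eta^{x-}$ is the configuration in which one particle is removed from $x$ ($\eta^{x-}=\eta$ if $\eta_x=0$). $\nabla_{xz}f(\eta)=f(\eta^{xz})-f(\eta)$, $\nabla_x^-f(\eta)=f(\eta^{x-})-f(\eta)$. The probability measure on $S_N$ is $$\nu_{V_n}^N(\eta)=\frac{1}{Z}\,\frac{e^{-H(\eta)}}{\prod_x[g_x(\eta_x)!]},\qquad [g_x(k)!]=\prod_{\ell=1}^kg_x(\ell),\ [g_x(0)!]=1,$$ with $Z$ the normalization. The rates are $c_x(\eta)=\frac1n g_x(\eta_x)e^{-\nabla_x^-H(\eta)}$, and the generator, reversible for $\nu_{V_n}^N$, is $$\mathcal{L}f(\eta)=\sum_{x,z\in V_n}c_x(\eta)\nabla_{xz}f(\eta)=\frac1n\sum_{x,z}g_x(\eta_x)e^{-\nabla_x^-H(\eta)}\nabla_{xz}f(\eta).$$ For $\eta_y>0$, $r_{x,y}(\eta):=c_y(\eta^{x-})/c_y(\eta)$; $\mathcal{M}_{x,y}(\eta):=n\sqrt{c_x(\eta)c_y(\eta)}\,(1-r_{x,y}(\eta))$, with $\mathcal{M}_{x,y}(\eta)=0$ if $\eta_x\eta_y=0$. $\varepsilon_x(\eta):=\sum_{y:\,y\neq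 x}\left|1-e^{-\nabla_x^-\nabla_y^-H(\eta)}\right|$. $\mathrm{gap}(\mathcal{L})\in[0,+\infty]$ is the largest $k\geq0$ such that $k\,(\nu[f^2]-\nu[f]^2)\leq-\nu[f\mathcal{L}f]$ for all $f:S_N\to\mathbb{R}$, where $\nu=\nu_{V_n}^N$. *)

(* Defs.v *)
From mathcomp Require Import all_boot all_order all_algebra.
From mathcomp Require Import all_classical all_reals all_analysis.

Set Implicit Arguments.
Unset Strict Implicit.
Unset Printing Implicit Defensive.

Import Order.TTheory GRing.Theory Num.Theory.

Local Open Scope classical_set_scope.
Local Open Scope ring_scope.

Definition config (V : finType) := {ffun V -> nat}.

Definition SN (V : finType) (N : nat) : set (config V) :=
  [set eta | (\sum_(x : V) eta x)%N = N].
Arguments SN V N : clear implicits.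

(* Sums over [SN V N] below are finitely supported sums [\sum_(eta \in SN V N)],
   which would collapse to [0] on an infinite support. *)
Lemma finite_SN (V : finType) (N : nat) : finite_set (SN V N).
Proof.
pose F (t : {ffun V -> 'I_N.+1}) : config V := [ffun x => nat_of_ord (t x)].
have fF : finite_set (F @` setT) by apply: finite_image; exact: finite_finset.
apply: (sub_finite_set _ fF) => eta /= etaN.
exists [ffun x => inord (eta x)] => //.
apply/ffunP => x; rewrite !ffunE inordK // ltnS -etaN.
by rewrite (bigD1 x) //= leq_addr.
Qed.

Section dynamics.
Variables (R : realType) (V : finType).
Implicit Types (x y z : V) (eta : config V) (f : config V -> R).

(* Truncated subtraction makes this the identity when [eta x = 0]. *)
Definition remove x eta : config V := [ffun u => (eta u - (u == x))%N].

Definition move x z eta : config V :=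
  if (eta x == 0%N) || (x == z) then eta
  else [ffun u => (eta u - (u == x) + (u == z))%N].

Lemma move_SN (N : nat) x z eta : SN V N eta -> SN V N (move x z eta).
Proof.
rewrite /SN /move /= => <-; case: ifPn => //; rewrite negb_or => /andP[ex xz].
rewrite (bigD1 x) //= (bigD1 z) 1?eq_sym //= [RHS](bigD1 x) //=.
rewrite [in RHS](bigD1 z) 1?eq_sym //= !ffunE !eqxx (negPf xz).
rewrite eq_sym (negPf xz) subn0 addn0 addn1 subn1 addnA addnS.
rewrite -[X in (X + _)%N]addSn prednK ?lt0n // -addnA.
congr (_ + (_ + _))%N; apply: eq_bigr => u /andP[/negPf ux /negPf uz].
by rewrite ffunE ux uz subn0 addn0.
Qed.

Definition nabla x z f eta : R := f (move x z eta) - f eta.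
Definition nablaM x f eta : R := f (remove x eta) - f eta.

Variables (g : V -> nat -> R) (H : config V -> R).

Definition gfact x (k : nat) : R := \prod_(1 <= l < k.+1) g x l.

Definition weight eta : R := expR (- H eta) / \prod_x gfact x (eta x).

Definition nu (N : nat) eta : R :=
  weight eta / \sum_(xi \in SN V N) weight xi.

Definition mean (N : nat) f : R := \sum_(eta \in SN V N) nu N eta * f eta.

Definition rate x eta : R :=
  #|V|%:R^-1 * g x (eta x) * expR (- nablaM x H eta).

Definition gen f eta : R := \sum_x \sum_z rate x eta * nabla x z f eta.

Definition ratio x y eta : R := rate y (remove x eta) / rate y eta.

Definition Mmx x y eta : R :=
  if (eta x * eta y == 0)%N then 0
  else #|V|%:R * Num.sqrt (rate x eta * rate y eta) * (1 - ratio x y eta).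

Definition eps x eta : R :=
  \sum_(y | y != x) `|1 - expR (- nablaM x (nablaM y H) eta)|.

(* By [move_SN] both sides of the inequality only see [f] on [SN V N], so test
   functions on all configurations stand for test functions on [SN V N]. *)
Definition poincare (N : nat) (k : R) : Prop :=
  forall f, k * (mean N (fun eta => f eta ^+ 2) - mean N f ^+ 2)
    <= - mean N (fun eta => f eta * gen f eta).

(* The admissible [k] form a closed set, so the supremum is the largest one,
   or [+oo] when all [k >= 0] are admissible. *)
Definition gap (N : nat) : \bar R :=
  ereal_sup [set k%:E | k in [set k : R | 0 <= k /\ poincare N k]].

End dynamics.

(* Main.v *)
(** The measure [nu] satisfies the balance identity
    [W eta * c_x eta = W (eta - e_x) / n] for the unnormalised weight [W], so
    averages of [sum_x c_x F_x] over [N + 1] particles become averages of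
    [sum_x F_x (xi + e_x)] over [N] particles. With the drift
    [D_x f = sum_z nabla_xz f] and [w_x = sqrt c_x * D_x f] this turns
    [n] times the Dirichlet form of [f] into the average of [sum_x w_x ^ 2],
    while the quadratic form of [M] at [w] equals
    [n ((L f)^2 - sum_(x, y) c_x eta * c_y (eta - e_x) * D_x f * D_y f)].
    Applying balance twice, the average of the subtracted sum is an average over
    [N - 1] particles of squared Hilbert-Schmidt norms, hence nonnegative. So
    [M >= delta] gives [nu (L f)^2 >= delta * nu (f (- L f))], which by
    self-adjointness and ergodicity of [L] on a finite state space is the
    Poincare inequality. The explicit bound is diagonal dominance of [M], whose
    off-diagonal entries involve [1 - exp (- nablaM x (nablaM y H))]. *)

From HB Require Import structures.
Require Import Defs.
From mathcomp Require Import all_boot all_order all_algebra.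
From mathcomp Require Import all_classical all_reals all_analysis.
From mathcomp Require Import finmap ring lra.

Set Implicit Arguments.
Unset Strict Implicit.
Unset Printing Implicit Defensive.

Import Order.TTheory GRing.Theory Num.Theory.

Local Open Scope classical_set_scope.
Local Open Scope ring_scope.

(** * Abstract Poincare criterion for operators on functions of finitely many points *)

(** Functions on [s] form a finite-dimensional space, where injective endomorphisms are onto. [lift]
    extends a row vector by zero outside [s], which gives [B] a square matrix. *)
Lemma linear_inj_surj (F : fieldType) (T : eqType) (s : seq T)
    (B : (T -> F) -> T -> F) :
  uniq s ->
  (forall a f h t, B (fun u => a * f u + h u) t = a * B f t + B h t) ->
  (forall f, {in s, forall t, B f t = 0} -> {in s, forall t, f t = 0}) ->
  forall f, exists h, {in s, forall t, B h t = f t}.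
Proof.
case: s => [|t0 s']; first by move=> *; exists (fun=> 0).
set s := t0 :: s' => us Blin Binj f.
pose lift (v : 'rV[F]_(size s)) : T -> F :=
  fun t => \sum_j v 0 j * (t == nth t0 s j)%:R.
have liftE v (i : 'I_(size s)) : lift v (nth t0 s i) = v 0 i.
  rewrite /lift (bigD1 i) //= eqxx mulr1 big1 ?addr0 // => j ji.
  by rewrite nth_uniq // eq_sym (negPf (ji : j != i :> nat)) mulr0.
pose mapB (v : 'rV[F]_(size s)) : 'rV[F]_(size s) :=
  \row_i B (lift v) (nth t0 s i).
have mapB_lin : linear mapB.
  move=> a u v; apply/rowP => i; rewrite !mxE -Blin; congr (B _ _).
  apply/funext => t; rewrite /lift mulr_sumr -big_split /=.
  by apply: eq_bigr => j _; rewrite !mxE mulrDl mulrA.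
pose mapBL : {linear 'rV[F]_(size s) -> 'rV[F]_(size s)} :=
  HB.pack mapB (GRing.isLinear.Build _ _ _ _ _ mapB_lin).
have Bfree : row_free (lin1_mx mapBL).
  apply: inj_row_free => v; rewrite mul_rV_lin1 /= => /rowP v0.
  have {}v0 : {in s, forall t, B (lift v) t = 0}.
    move=> t ts; move: (v0 (Ordinal (etrans (index_mem t s) ts))).
    by rewrite !mxE /= nth_index.
  by apply/rowP => i; rewrite mxE -liftE (Binj _ v0) // mem_nth.
pose v := (\row_i f (nth t0 s i)) *m invmx (lin1_mx mapBL).
exists (lift v) => t ts.
have /rowP/(_ (Ordinal (etrans (index_mem t s) ts))) :
    mapBL v = \row_i f (nth t0 s i).
  by rewrite -mul_rV_lin1 mulmxKV // -row_free_unit.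
by rewrite !mxE /= nth_index.
Qed.

(** Diagonalisation is avoided: for centered [f], solve [A h = f] on [s]. The last hypothesis at [h]
    reads [delta * E (h * A h) <= E (f ^ 2)], and positivity of [A] at [f - delta * h] gives [E (f *
    A f) >= 2 * delta * E (f ^ 2) - delta ^ 2 * E (h * A h)], which is at least
    [delta * E (f ^ 2)]. *)
Lemma poincare_of_bochner (R : realFieldType) (T : eqType) (s : seq T)
    (p : T -> R) (A : (T -> R) -> T -> R) (delta : R) :
  uniq s -> 0 < delta -> \sum_(t <- s) p t = 1 ->
  (forall a f h t, A (fun u => a * f u + h u) t = a * A f t + A h t) ->
  (forall f h, \sum_(t <- s) p t * (f t * A h t) =
               \sum_(t <- s) p t * (h t * A f t)) ->
  (forall f, 0 <= \sum_(t <- s) p t * (f t * A f t)) ->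
  (forall f, \sum_(t <- s) p t * (f t * A f t) = 0 ->
     exists c, {in s, forall t, f t = c}) ->
  (forall c t, A (fun=> c) t = 0) ->
  (forall f, delta * \sum_(t <- s) p t * (f t * A f t) <=
             \sum_(t <- s) p t * A f t ^+ 2) ->
  forall f, delta * (\sum_(t <- s) p t * f t ^+ 2
                     - (\sum_(t <- s) p t * f t) ^+ 2)
            <= \sum_(t <- s) p t * (f t * A f t).
Proof.
move=> us d0 p1 Alin Asym Age0 Aker Acst Abochner f0.
pose E (f : T -> R) := \sum_(t <- s) p t * f t.
(* The kernel of [A] consists of the constants; adding the mean makes the operator injective. *)
pose B (f : T -> R) t := A f t + E f.
have EA f : E (A f) = 0.
  have := Asym (fun=> 1) f; under eq_bigr do rewrite mul1r.
  by rewrite /E => ->; apply: big1 => t _; rewrite Acst !mulr0.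
have ED f h : E (fun t => f t + h t) = E f + E h.
  by rewrite /E -big_split; apply: eq_bigr => t _; rewrite mulrDr.
have EZ c f : E (fun t => c * f t) = c * E f.
  by rewrite /E mulr_sumr; apply: eq_bigr => t _; rewrite mulrCA.
have Ecst c : E (fun=> c) = c by rewrite /E -mulr_suml p1 mul1r.
have eqE f h : {in s, f =1 h} -> E f = E h.
  by move=> fh; apply: eq_big_seq => t ts; rewrite fh.
have Blin a f h t : B (fun u => a * f u + h u) t = a * B f t + B h t.
  by rewrite /B Alin ED EZ; ring.
have EB f : E (B f) = E f by rewrite /B ED EA Ecst add0r.
have Binj f : {in s, forall t, B f t = 0} -> {in s, forall t, f t = 0}.
  move=> Bf0.
  have Ef0 : E f = 0 by rewrite -EB (eqE _ (fun=> 0)) ?Ecst.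
  have [|c fc] := Aker f.
    apply: big1_seq => t /andP[_ ts].
    by have := Bf0 _ ts; rewrite /B Ef0 addr0 => ->; rewrite !mulr0.
  by move=> t ts; rewrite (fc _ ts) -(Ecst c) -(eqE _ _ fc).
pose m := E f0.
pose f t := f0 t + - m.
have Ef : E f = 0 by rewrite /f ED Ecst subrr.
have Af t : A f t = A f0 t.
  have := Alin 1 f0 (fun=> - m) t; rewrite Acst mul1r addr0 => <-.
  by congr (A _ _); apply/funext => u; rewrite mul1r.
have -> : \sum_(t <- s) p t * (f0 t * A f0 t) = E (fun t => f t * A f t).
  rewrite -[LHS]/(E (fun t => f0 t * A f0 t)).
  have -> : (fun t => f t * A f t) = (fun t => f0 t * A f0 t + - m * A f0 t).
    by apply/funext => t; rewrite Af /f mulrDl.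
  by rewrite ED EZ EA mulr0 addr0.
have -> : \sum_(t <- s) p t * f0 t ^+ 2 - (\sum_(t <- s) p t * f0 t) ^+ 2
    = E (fun t => f t ^+ 2).
  rewrite -[_ - _]/(E (fun t => f0 t ^+ 2) - m ^+ 2).
  have -> : (fun t => f t ^+ 2)
      = (fun t => f0 t ^+ 2 + (- (2 * m) * f0 t + m ^+ 2)).
    by apply/funext => t; rewrite /f; ring.
  by rewrite !ED EZ Ecst -/m; ring.
have [h Bh] := linear_inj_surj us Blin Binj f.
(* [E h = E (B h) = E f = 0], so the mean part of [B h] disappears. *)
have Ah : {in s, A h =1 f}.
  by move=> t ts; have := Bh t ts; rewrite /B -EB (eqE _ _ Bh) Ef addr0.
have hAf : E (fun t => h t * A f t) = E (fun t => f t ^+ 2).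
  by rewrite /E Asym; apply: eq_big_seq => t ts; rewrite Ah ?expr2.
have fAh : E (fun t => f t * A h t) = E (fun t => f t ^+ 2).
  by apply: eqE => t ts; rewrite Ah ?expr2.
have := Abochner h; rewrite -/(E (fun t => A h t ^+ 2)).
rewrite (eqE _ (fun t => f t ^+ 2)); last by move=> t ts; rewrite Ah.
rewrite -/(E (fun t => h t * A h t)) => hb.
(* Positivity of [A] at [f - delta h], where [A h = f]. *)
have := Age0 (fun t => - delta * h t + f t).
rewrite -[X in 0 <= X]/(E _).
have -> : (fun t => (- delta * h t + f t) * A (fun u => - delta * h u + f u) t)
  = (fun t => delta ^+ 2 * (h t * A h t) + (- delta * (h t * A f t)
       + (- delta * (f t * A h t) + f t * A f t))).
  by apply/funext => t; rewrite Alin; ring.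
rewrite !ED !EZ hAf fAh.
move: hb; rewrite -(ler_pM2l d0) => hb.
lra.
Qed.

(** * Adding and removing particles *)

Section configurations.
Variable V : finType.
Implicit Types (x y z : V) (eta xi : config V).

Definition add x eta : config V := [ffun u => (eta u + (u == x))%N].

Lemma addK x eta : remove x (add x eta) = eta.
Proof. by apply/ffunP => u; rewrite !ffunE addnK. Qed.

Lemma removeK x eta : (0 < eta x)%N -> add x (remove x eta) = eta.
Proof.
move=> ex; apply/ffunP => u; rewrite !ffunE subnK //.
by have [->|] := eqVneq u x.
Qed.

Lemma add_gt0 x eta : (0 < add x eta x)%N.
Proof. by rewrite ffunE eqxx addn1. Qed.

Lemma addC x y eta : add x (add y eta) = add y (add x eta).
Proof. by apply/ffunP => u; rewrite !ffunE addnAC. Qed.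

Lemma removeC x y eta : remove x (remove y eta) = remove y (remove x eta).
Proof. by apply/ffunP => u; rewrite !ffunE subnAC. Qed.

Lemma move_add x z xi : move x z (add x xi) = add z xi.
Proof.
rewrite /move eqn0Ngt add_gt0 /=.
have [->//|xz] := eqVneq x z.
by apply/ffunP => u; rewrite !ffunE addnK.
Qed.

Lemma SN_add N x xi : SN V N xi -> SN V N.+1 (add x xi).
Proof.
rewrite /SN /= => <-; under eq_bigr do rewrite ffunE.
rewrite big_split /= [X in (_ + X)%N](bigD1 x) //= eqxx.
rewrite [X in (_ + (_ + X))%N]big1 ?addn0 ?addn1 //.
by move=> u /negPf ->.
Qed.

(** A duplicate-free sequence in place of the set [SN V N], so that sums can be filtered and
    reindexed. *)
Definition levels N : seq (config V) := fset_set (SN V N).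

Lemma levels_uniq N : uniq (levels N).
Proof. exact: fset_uniq. Qed.

Lemma mem_levels N eta : (eta \in levels N) = ((\sum_x eta x)%N == N).
Proof.
rewrite -[LHS]/(eta \in fset_set (SN V N)).
rewrite in_fset_set; last exact: finite_SN.
by apply/idP/eqP => [/set_mem|/mem_set].
Qed.

(** The change of variables behind every passage from [N + 1] to [N] particles. *)
Lemma perm_levels_add N x :
  perm_eq [seq eta : config V <- levels N.+1 | (0 < eta x)%N]
          [seq add x xi | xi <- levels N].
Proof.
apply: uniq_perm.
- by rewrite filter_uniq // levels_uniq.
- by rewrite map_inj_uniq ?levels_uniq //; exact: can_inj (addK x).
move=> eta; rewrite mem_filter mem_levels; apply/andP/mapP.
  move=> [ex /eqP etaN]; exists (remove x eta); last by rewrite removeK.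
  rewrite mem_levels -eqSS -etaN; apply/eqP.
  by rewrite -(SN_add x (erefl (\sum_u remove x eta u)%N)) removeK.
by move=> [xi]; rewrite mem_levels => /eqP/(SN_add x)/eqP ? ->; rewrite add_gt0.
Qed.
End configurations.

(** * Balance identity and Dirichlet form *)

Section dynamics.
Variables (R : realType) (V : finType) (g : V -> nat -> R) (H : config V -> R).
Hypothesis g_0 : forall x, g x 0%N = 0.
Hypothesis g_ge1 : forall x k, (1 <= k)%N -> 1 <= g x k.
Implicit Types (x y z : V) (eta xi : config V) (f h : config V -> R).

Local Notation n := (#|V|%:R : R).
Local Notation c := (rate g H).
Local Notation W := (weight g H).
Local Notation levels N := (levels V N).

Lemma meanE N f :
  mean g H N f =
  (\sum_(eta <- levels N) W eta)^-1 * \sum_(eta <- levels N) W eta * f eta.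
Proof.
rewrite /mean fsbig_finite ?mulr_sumr; last exact: finite_SN.
apply: eq_bigr => eta _; rewrite /nu fsbig_finite; last exact: finite_SN.
by rewrite mulrAC mulrC.
Qed.

Lemma g_gt0 x k : (0 < k)%N -> 0 < g x k.
Proof. by move=> /(g_ge1 x); apply: lt_le_trans. Qed.

Lemma gfact_gt0 x k : 0 < gfact g x k.
Proof.
rewrite /gfact big_nat_cond; apply: prodr_gt0 => l /andP[/andP[l0 _] _].
exact: g_gt0.
Qed.

Lemma weight_gt0 eta : 0 < W eta.
Proof.
by rewrite divr_gt0 ?expR_gt0 //; apply: prodr_gt0 => x _; exact: gfact_gt0.
Qed.

Lemma weight_ge0 eta : 0 <= W eta.
Proof. exact/ltW/weight_gt0. Qed.

Lemma card_gt0R x : 0 < n.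
Proof. by rewrite ltr0n; apply/card_gt0P; exists x. Qed.

Lemma rate_gt0 x eta : (0 < eta x)%N -> 0 < c x eta.
Proof.
by move=> ex; rewrite !mulr_gt0 ?expR_gt0 ?g_gt0 // invr_gt0 (card_gt0R x).
Qed.

Lemma rate_eq0 x eta : eta x = 0%N -> c x eta = 0.
Proof. by move=> ex; rewrite /rate ex g_0 mulr0 mul0r. Qed.

Lemma rate_ge0 x eta : 0 <= c x eta.
Proof.
by have [/rate_eq0->//|/rate_gt0/ltW] := posnP (eta x).
Qed.

(** The factor [g] of the rate cancels the new factor of [gfact], and its exponential trades
    [H (add x xi)] for [H xi]. *)
Lemma weight_rate_add x xi : W (add x xi) * c x (add x xi) = n^-1 * W xi.
Proof.
rewrite /weight /rate /nablaM addK.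
have -> : add x xi x = (xi x).+1 by rewrite ffunE eqxx addn1.
have -> : \prod_y gfact g y (add x xi y)
    = g x (xi x).+1 * \prod_y gfact g y (xi y).
  rewrite (bigD1 x) //= [in RHS](bigD1 x) //= mulrA; congr (_ * _).
    by rewrite ffunE eqxx addn1 /gfact big_nat_recr //= mulrC.
  by apply: eq_bigr => y /negPf yx; rewrite ffunE yx addn0.
have -> : expR (- (H xi - H (add x xi))) = expR (- H xi) / expR (- H (add x xi)).
  by rewrite -expRN -expRD; congr expR; ring.
have p0 : \prod_y gfact g y (xi y) != 0.
  by rewrite gt_eqF //; apply: prodr_gt0 => y _; exact: gfact_gt0.
have q0 : g x (xi x).+1 != 0 by rewrite gt_eqF // g_gt0.
have e0 := lt0r_neq0 (expR_gt0 (- H (add x xi))).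
have n0 := lt0r_neq0 (card_gt0R x).
by field; rewrite n0 e0 p0 q0.
Qed.

Lemma sum_rate N x (F : config V -> R) :
  \sum_(eta <- levels N.+1) W eta * (c x eta * F eta)
  = n^-1 * \sum_(xi <- levels N) W xi * F (add x xi).
Proof.
(* Configurations empty at [x] have zero rate; all others are of the form [add x xi]. *)
rewrite (bigID (fun eta => 0 < eta x)%N) /= [X in _ + X]big1 ?addr0; last first.
  by move=> eta; rewrite -eqn0Ngt => /eqP/rate_eq0 ->; rewrite mul0r mulr0.
rewrite -big_filter (perm_big _ (perm_levels_add N x)) big_map mulr_sumr.
by apply: eq_bigr => xi _; rewrite mulrA weight_rate_add -mulrA.
Qed.

Lemma sum_sum_rate N (F : V -> config V -> R) :
  \sum_(eta <- levels N.+1) W eta * (\sum_x c x eta * F x eta)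
  = n^-1 * \sum_(xi <- levels N) W xi * \sum_x F x (add x xi).
Proof.
under eq_bigr do rewrite mulr_sumr.
under [in RHS]eq_bigr do rewrite mulr_sumr.
rewrite exchange_big [in RHS]exchange_big mulr_sumr.
by apply: eq_bigr => x _; rewrite sum_rate.
Qed.

Definition drift f x eta : R := \sum_z nabla x z f eta.

Lemma genE f eta : gen g H f eta = \sum_x c x eta * drift f x eta.
Proof. by apply: eq_bigr => x _; rewrite mulr_sumr. Qed.

(** Seen from [xi], the drift is the complete-graph Laplacian of [z |-> f (add z xi)] at [x]; in
    particular its sum over [x] vanishes. *)
Lemma drift_add f x xi :
  drift f x (add x xi) = \sum_z f (add z xi) - n * f (add x xi).
Proof.
rewrite /drift /nabla sumrB sumr_const mulr_natl; congr (_ - _).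
by apply: eq_bigr => z _; rewrite move_add.
Qed.

Lemma sum_sub_sum (a : V -> R) :
  \sum_x (\sum_z a z - n * a x) = 0.
Proof.
by rewrite sumrB -mulr_sumr sumr_const mulr_natl subrr.
Qed.

(** Integration by parts: after one use of balance, the drifts of [h] sum to zero over [x], so
    [- f (add x xi)] may be replaced by [n^-1 * drift f x (add x xi)]. The outcome is symmetric in
    [f] and [h]. *)
Lemma dirichlet N f h :
  \sum_(eta <- levels N.+1) W eta * (f eta * - gen g H h eta)
  = n^-1 ^+ 2 * \sum_(xi <- levels N) W xi *
      \sum_x drift f x (add x xi) * drift h x (add x xi).
Proof.
have -> : \sum_(eta <- levels N.+1) W eta * (f eta * - gen g H h eta) =
    \sum_(eta <- levels N.+1) W eta *
      \sum_x c x eta * (- f eta * drift h x eta).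
  apply: eq_bigr => eta _; congr (_ * _); rewrite genE mulrN -mulNr mulr_sumr.
  by apply: eq_bigr => x _; rewrite mulrCA.
rewrite sum_sum_rate expr2 -mulrA; congr (_ * _).
rewrite mulr_sumr; apply: eq_bigr => xi _; rewrite mulrCA; congr (_ * _).
under eq_bigr do rewrite drift_add.
under [in RHS]eq_bigr do rewrite !drift_add mulrBl.
rewrite sumrB -mulr_sumr sum_sub_sum mulr0 sub0r mulrN mulr_sumr -sumrN.
apply: eq_bigr => x _; rewrite mulNr -[n * _ * _]mulrA mulKf //.
exact: lt0r_neq0 (card_gt0R x).
Qed.

Lemma dirichlet_sym N f h :
  \sum_(eta <- levels N.+1) W eta * (f eta * - gen g H h eta)
  = \sum_(eta <- levels N.+1) W eta * (h eta * - gen g H f eta).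
Proof.
rewrite !dirichlet; congr (_ * _); apply: eq_bigr => xi _; congr (_ * _).
by apply: eq_bigr => x _; rewrite mulrC.
Qed.

Lemma dirichlet_ge0 N f :
  0 <= \sum_(eta <- levels N.+1) W eta * (f eta * - gen g H f eta).
Proof.
rewrite dirichlet mulr_ge0 ?exprn_ge0 ?invr_ge0 ?ler0n // sumr_ge0 // => xi _.
rewrite mulr_ge0 ?weight_ge0 // sumr_ge0 // => x _.
by rewrite -expr2 sqr_ge0.
Qed.

(** * Kernel of the Dirichlet form and positivity of the pair term *)

(** Particles are carried to [o] one at a time without changing [f]; the induction is on the number
    of particles away from [o]. *)
Lemma add_invariant_const N f (o : V) :
  (forall xi x z, SN V N xi -> f (add x xi) = f (add z xi)) ->
  exists k, {in levels N.+1, forall eta, f eta = k}.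
Proof.
move=> finv.
have stack k eta : SN V N.+1 eta -> (N.+1 - eta o)%N = k ->
    f eta = f [ffun u => if u == o then N.+1 else 0%N].
  elim: k eta => [|k IH] eta etaN etao.
    congr f; apply/ffunP => u; rewrite ffunE; move: etaN; rewrite /SN /=.
    rewrite (bigD1 o) //= => etaN.
    have eo : eta o = N.+1.
      apply/eqP; rewrite eqn_leq -{1}etaN leq_addr /=.
      by rewrite -subn_eq0 etao.
    have [->//|uo] := eqVneq u o.
    move/eqP: etaN; rewrite eo -[X in _ == X]addn0 eqn_add2l sum_nat_eq0.
    by move=> /forallP/(_ u); rewrite uo => /eqP.
  have [x xo ex] : exists2 x, x != o & (0 < eta x)%N.
    apply/exists_inP; rewrite -[X in is_true X]negbK negb_exists_in.
    apply/negP => /forall_inP e0; move: etaN; rewrite /SN /= (bigD1 o) //= big1.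
      by rewrite addn0 => eo; move: etao; rewrite eo subnn.
    by move=> u /e0; rewrite -eqn0Ngt => /eqP.
  have xiN : SN V N (remove x eta).
    apply/eqP; rewrite -eqSS -etaN; apply/eqP.
    by rewrite -(SN_add x (erefl (\sum_u remove x eta u)%N)) removeK.
  rewrite -{1}(removeK ex) (finv _ x o xiN); apply: IH; first exact: SN_add.
  by rewrite !ffunE eqxx eq_sym (negPf xo) subn0 addn1 subnS etao.
exists (f [ffun u => if u == o then N.+1 else 0%N]) => eta.
by rewrite mem_levels => /eqP etaN; exact: stack etaN erefl.
Qed.

(** Positive weights force every drift to vanish, so [f (add x xi)] equals its average over [x],
    whatever [x] is. *)
Lemma dirichlet_eq0 N f (o : V) :
  \sum_(eta <- levels N.+1) W eta * (f eta * - gen g H f eta) = 0 ->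
  exists k, {in levels N.+1, forall eta, f eta = k}.
Proof.
rewrite dirichlet => /eqP; rewrite mulf_eq0 expf_eq0 /= invr_eq0.
have n0 := card_gt0R o; rewrite (gt_eqF n0) /= => E0.
apply: (add_invariant_const o) => xi x z xiN.
have drift0 y : drift f y (add y xi) = 0.
  move: E0; rewrite psumr_eq0; last first.
    move=> zeta _; rewrite mulr_ge0 ?weight_ge0 // sumr_ge0 // => u _.
    by rewrite -expr2 sqr_ge0.
  move=> /allP/(_ xi); rewrite mem_levels => /(_ (introT eqP xiN)) /=.
  rewrite mulf_eq0 (gt_eqF (weight_gt0 xi)) /= psumr_eq0; last first.
    by move=> u _; rewrite -expr2 sqr_ge0.
  move=> /allP/(_ y); rewrite mem_index_enum => /(_ isT) /=.
  by rewrite mulf_eq0 orbb => /eqP.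
have := drift0 x; rewrite -(drift0 z) !drift_add => /addrI/oppr_inj.
by apply: mulfI; rewrite gt_eqF.
Qed.

(* The integrand is [n^2] times the squared Hilbert-Schmidt norm of the doubly
   centered symmetric matrix [f (xi + e_x + e_y)]. *)
Lemma drift_pair_ge0 f xi :
  0 <= \sum_x \sum_y drift f x (add x (add y xi)) * drift f y (add x (add y xi)).
Proof.
pose F x y := f (add x (add y xi)); pose S x := \sum_y F x y.
pose T := \sum_x S x.
have FC x y : F x y = F y x by rewrite /F addC.
suff -> : \sum_x \sum_y drift f x (add x (add y xi))
      * drift f y (add x (add y xi))
    = \sum_x \sum_y (n * F x y - S x - S y + n^-1 * T) ^+ 2.
  by do 2! apply: sumr_ge0 => ? _; exact: sqr_ge0.
have -> : \sum_x \sum_y drift f x (add x (add y xi))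
      * drift f y (add x (add y xi))
    = \sum_x \sum_y (S y - n * F x y) * (S x - n * F x y).
  apply: eq_bigr => x _; apply: eq_bigr => y _.
  rewrite drift_add addC drift_add; congr ((_ - n * _) * (_ - n * _)).
  - by apply: eq_bigr => z _; rewrite -[LHS]/(F z y) FC.
  - exact: FC.
  - by apply: eq_bigr => z _; rewrite -[LHS]/(F z x) FC.
  - exact: FC.
(* [A x y + A y x + B x y] is the difference between the square and the product. [A] and [B] have
   zero row sums, so it contributes nothing in total. *)
pose A x y := (S x - n^-1 * T) * (S x - n * F x y).
pose B x y := (S x - n^-1 * T) * (S y - n^-1 * T).
have A0 x : \sum_y A x y = 0 by rewrite -mulr_sumr sum_sub_sum mulr0.
have B0 x : \sum_y B x y = 0.
  rewrite -mulr_sumr sumrB sumr_const -[(_ * T) *+ _]mulr_natl.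
  rewrite mulVKf ?subrr ?mulr0 //.
  exact: lt0r_neq0 (card_gt0R x).
have AB0 : \sum_x \sum_y (A x y + A y x + B x y) = 0.
  under eq_bigr do rewrite !big_split /= A0 B0 add0r addr0.
  by rewrite exchange_big big1.
rewrite -[RHS]subr0 -[X in _ = _ - X]AB0 -sumrB; apply: eq_bigr => x _.
rewrite -sumrB; apply: eq_bigr => y _; rewrite /A /B (FC y x).
have n0 := lt0r_neq0 (card_gt0R x).
by field.
Qed.

Lemma rate_pair_ge0 N f :
  0 <= \sum_(eta <- levels N.+1) W eta * \sum_x c x eta *
         \sum_y c y (remove x eta) * (drift f x eta * drift f y eta).
Proof.
rewrite sum_sum_rate mulr_ge0 ?invr_ge0 ?ler0n //.
(* At [add x xi] the removal of [x] gives back [xi], so the second rate is [c y xi] and balance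
   applies again. *)
under eq_bigr => xi _ do under eq_bigr => x _ do
  under eq_bigr => y _ do rewrite addK.
(* With a single particle, nothing is left after its removal and the second rate vanishes. *)
case: N => [|N].
  rewrite big1_seq // => xi /andP[_]; rewrite mem_levels sum_nat_eq0.
  move=> /forallP xi0; rewrite big1 ?mulr0 // => x _; apply: big1 => y _.
  by rewrite rate_eq0 ?mul0r //; apply/eqP/xi0.
under eq_bigr do rewrite exchange_big /=.
under eq_bigr => xi _ do under eq_bigr => x _ do rewrite -mulr_sumr.
rewrite (sum_sum_rate N (fun y xi =>
  \sum_x drift f x (add x xi) * drift f y (add x xi))).
rewrite mulr_ge0 ?invr_ge0 ?ler0n // sumr_ge0 // => xi _.
by rewrite mulr_ge0 ?weight_ge0 // exchange_big drift_pair_ge0.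
Qed.

(** * The quadratic form of [Mmx] and the Poincare inequality *)

(** The square roots in [w] and [Mmx] pair up to [c x eta * c y eta], and multiplying by [ratio]
    replaces [c y eta] by [c y (remove x eta)]. *)
Lemma Mmx_sqrt_rate eta (D : V -> R) (w := fun x => Num.sqrt (c x eta) * D x) :
  \sum_x \sum_y w x * Mmx g H x y eta * w y
  = n * ((\sum_x c x eta * D x) ^+ 2 - \sum_x c x eta *
      \sum_y c y (remove x eta) * (D x * D y)).
Proof.
rewrite expr2 big_distrlr /= mulrBr !mulr_sumr -sumrB.
apply: eq_bigr => x _; rewrite !mulr_sumr -sumrB.
apply: eq_bigr => y _; rewrite /w /Mmx muln_eq0.
have [/rate_eq0->|ex] := eqVneq (eta x) 0%N; first by rewrite !(mul0r, mulr0) subr0.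
have [ey|ey] := eqVneq (eta y) 0%N.
  (* By truncated subtraction [y] stays empty, so the rate after the removal vanishes too. *)
  have ey' : remove x eta y = 0%N by rewrite ffunE ey.
  by rewrite (rate_eq0 ey) (rate_eq0 ey') !(mul0r, mulr0) subr0.
have cy0 : c y eta != 0 by rewrite gt_eqF // rate_gt0 // lt0n.
have cx := sqr_sqrtr (rate_ge0 x eta); have cy := sqr_sqrtr (rate_ge0 y eta).
rewrite /= [Num.sqrt (c x eta * _)]sqrtrM ?rate_ge0 // /Defs.ratio.
transitivity (n * (Num.sqrt (c x eta) ^+ 2 * Num.sqrt (c y eta) ^+ 2)
  * (1 - c y (remove x eta) / c y eta) * (D x * D y)).
  by ring.
by rewrite cx cy; field.
Qed.

Lemma oppr_mean_gen N f :
  - mean g H N (fun eta => f eta * gen g H f eta)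
  = mean g H N (fun eta => f eta * - gen g H f eta).
Proof.
rewrite !meanE -mulrN -sumrN; congr (_ * _).
by apply: eq_bigr => eta _; rewrite !mulrN.
Qed.

(** Makes 0 admissible in [gap], which settles the explicit bound when it is not positive. *)
Lemma poincare0 N : poincare g H N.+1 0.
Proof.
move=> f; rewrite mul0r oppr_mean_gen meanE mulr_ge0 ?dirichlet_ge0 // invr_ge0.
by apply: sumr_ge0 => eta _; exact: weight_ge0.
Qed.

Section lower_bound.
Variables (N : nat) (delta : R) (o : V).
Hypothesis delta_gt0 : 0 < delta.
Hypothesis Mmx_ge : forall eta (w : V -> R),
  SN V N.+1 eta -> (forall x, eta x = 0%N -> w x = 0) ->
  delta * \sum_x w x ^+ 2 <= \sum_x \sum_y w x * Mmx g H x y eta * w y.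

Lemma bochner f :
  delta * \sum_(eta <- levels N.+1) W eta * (f eta * - gen g H f eta)
  <= \sum_(eta <- levels N.+1) W eta * gen g H f eta ^+ 2.
Proof.
have n0 := card_gt0R o.
have -> : \sum_(eta <- levels N.+1) W eta * (f eta * - gen g H f eta) =
    n^-1 * \sum_(eta <- levels N.+1) W eta *
      \sum_x c x eta * drift f x eta ^+ 2.
  by rewrite dirichlet sum_sum_rate mulrA.
rewrite -(ler_pM2l n0) mulrCA mulVKf ?gt_eqF //.
(* The middle term averages the quadratic form at [sqrt c_x * drift f x], a vector vanishing on
   empty sites; the nonnegative pair term is then dropped. *)
apply: (@le_trans _ _ (n * \sum_(eta <- levels N.+1) W eta * (gen g H f eta ^+ 2
    - \sum_x c x eta *
        \sum_y c y (remove x eta) * (drift f x eta * drift f y eta)))).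
  rewrite !mulr_sumr big_seq [leRHS]big_seq.
  apply: ler_sum => eta; rewrite mem_levels => /eqP etaN.
  rewrite mulrCA [leRHS]mulrCA ler_pM2l ?weight_gt0 // genE -Mmx_sqrt_rate.
  have -> : \sum_x c x eta * drift f x eta ^+ 2
      = \sum_x (Num.sqrt (c x eta) * drift f x eta) ^+ 2.
    by apply: eq_bigr => x _; rewrite exprMn sqr_sqrtr ?rate_ge0.
  by apply: Mmx_ge => // x /rate_eq0 ->; rewrite sqrtr0 mul0r.
rewrite ler_pM2l //; under eq_bigr do rewrite mulrBr.
by rewrite sumrB gerBl rate_pair_ge0.
Qed.

Lemma poincare_lower_bound : poincare g H N.+1 delta.
Proof.
pose Z := \sum_(eta <- levels N.+1) W eta.
have Z_gt0 : 0 < Z.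
  rewrite lt0r sumr_ge0 ?andbT; last by move=> eta _; exact: weight_ge0.
  rewrite psumr_neq0; last by move=> eta _; exact: weight_ge0.
  (* One configuration suffices for [Z > 0]: all particles at [o]. *)
  apply/hasP; exists [ffun u => if u == o then N.+1 else 0%N].
    rewrite mem_levels (bigD1 o) //= ffunE eqxx big1 ?addn0 // => u /negPf uo.
    by rewrite ffunE uo.
  exact: weight_gt0.
have nuE F : \sum_(eta <- levels N.+1) nu g H N.+1 eta * F eta =
    Z^-1 * \sum_(eta <- levels N.+1) W eta * F eta.
  by rewrite -meanE /mean fsbig_finite //; exact: finite_SN.
have Zi_ge0 : 0 <= Z^-1 by rewrite invr_ge0 ltW.
move=> f; rewrite oppr_mean_gen !meanE -!nuE.
apply: (@poincare_of_bochner R _ _ _ (fun f eta => - gen g H f eta)) => //.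
- exact: levels_uniq.
- have := nuE (fun=> 1); under eq_bigr do rewrite mulr1.
  by move=> ->; under eq_bigr do rewrite mulr1; rewrite mulVf ?gt_eqF.
- move=> a f1 f2 eta; rewrite mulrN -opprD; congr (- _).
  rewrite /gen mulr_sumr -big_split /=; apply: eq_bigr => x _.
  rewrite mulr_sumr -big_split /=; apply: eq_bigr => z _.
  by rewrite /nabla; ring.
- by move=> f1 f2; rewrite !nuE dirichlet_sym.
- by move=> f1; rewrite nuE mulr_ge0 ?dirichlet_ge0.
- move=> f1; rewrite nuE => /eqP; rewrite mulf_eq0 invr_eq0 (gt_eqF Z_gt0) /=.
  by move=> /eqP; apply: dirichlet_eq0.
- move=> k eta; rewrite /gen big1 ?oppr0 // => x _; rewrite big1 // => z _.
  by rewrite /nabla subrr mulr0.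
move=> f1; rewrite !nuE mulrCA ler_wpM2l //.
by under [leRHS]eq_bigr do rewrite sqrrN; exact: bochner.
Qed.

End lower_bound.

(** * Diagonal dominance *)

(** Removing a particle at [x] leaves [g y (eta y)] unchanged, so only the second difference of [H]
    survives. *)
Lemma ratio_neq x y eta : x != y -> (0 < eta y)%N ->
  Defs.ratio g H x y eta = expR (- nablaM x (nablaM y H) eta).
Proof.
move=> xy ey; have cy0 := lt0r_neq0 (rate_gt0 ey).
have gy0 := lt0r_neq0 (g_gt0 y ey); have n0 := lt0r_neq0 (card_gt0R y).
apply: (mulIf cy0); rewrite divfK // /rate [remove x eta y]ffunE eq_sym (negPf xy).
rewrite subn0 mulrCA -expRD; congr (_ * expR _).
by rewrite /nablaM; ring.
Qed.

(** Each off-diagonal term is bounded by [2 |u v| <= u ^ 2 + v ^ 2] with [u = sqrt c_x * w x] and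
    [v = sqrt c_y * w y]. Its cost is split evenly between [x] and [y]; by symmetry of [e], site [x]
    pays [eps H x eta] times [q x] in total. *)
Lemma Mmx_diag_dominant eta (w : V -> R) (delta : R) :
  (forall x, (0 < eta x)%N ->
     delta <= n * c x eta * (1 - c x (remove x eta) / c x eta - eps H x eta)) ->
  (forall x, eta x = 0%N -> w x = 0) ->
  delta * \sum_x w x ^+ 2 <= \sum_x \sum_y w x * Mmx g H x y eta * w y.
Proof.
move=> dle w0; pose e x y := `|1 - expR (- nablaM x (nablaM y H) eta)|.
have eC x y : e x y = e y x.
  by rewrite /e /nablaM removeC; congr `|1 - expR _|; ring.
pose q x := n * c x eta * w x ^+ 2.
have q_ge0 x : 0 <= q x by rewrite mulr_ge0 ?sqr_ge0 // mulr_ge0 ?ler0n ?rate_ge0.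
have offdiag x y : y != x ->
    - (q x * e x y + q y * e x y) / 2 <= w x * Mmx g H x y eta * w y.
  move=> yx; rewrite /Mmx muln_eq0.
  have e0 : 0 <= e x y by exact: normr_ge0.
  have e1 := mulr_ge0 (q_ge0 x) e0; have e2 := mulr_ge0 (q_ge0 y) e0.
  case: ifPn => [_|]; first by rewrite mulr0 mul0r; lra.
  rewrite negb_or -!lt0n => /andP[ex ey].
  rewrite ratio_neq 1?eq_sym // [Num.sqrt (c x eta * _)]sqrtrM ?rate_ge0 //.
  set t := 1 - _; set a := Num.sqrt _; set b := Num.sqrt _.
  have -> : q x = n * (a * w x) ^+ 2.
    by rewrite exprMn sqr_sqrtr ?rate_ge0 // mulrA.
  have -> : q y = n * (b * w y) ^+ 2.
    by rewrite exprMn sqr_sqrtr ?rate_ge0 // mulrA.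
  have -> : e x y = `|t| by [].
  have -> : w x * (n * (a * b) * t) * w y = n * ((a * w x) * (b * w y) * t).
    by ring.
  have -> : - (n * (a * w x) ^+ 2 * `|t| + n * (b * w y) ^+ 2 * `|t|) / 2
      = n * (- ((a * w x) ^+ 2 + (b * w y) ^+ 2) / 2 * `|t|) by field.
  apply: ler_wpM2l; first exact: ler0n.
  set u := a * w x; set v := b * w y.
  have uv1 := sqr_ge0 (u + v); have uv2 := sqr_ge0 (u - v).
  by have [t0|t0] := ler0P t; nra.
(* Exchanging [x] and [y] merges the two half costs into one. *)
have sumq : \sum_x \sum_(y | y != x) q y * e x y
    = \sum_x \sum_(y | y != x) q x * e x y.
  rewrite (exchange_big_dep xpredT) //=; apply: eq_bigr => y _.
  by apply: eq_big => [x|x _]; rewrite 1?eq_sym 1?eC.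
apply: (@le_trans _ _ (\sum_x (w x * Mmx g H x x eta * w x
    - \sum_(y | y != x) q x * e x y))).
  rewrite mulr_sumr; apply: ler_sum => x _; rewrite -mulr_sumr -/(eps H x eta).
  have [ex|ex] := posnP (eta x); first by rewrite /q (w0 x ex); lra.
  rewrite /Mmx muln_eq0 orbb (gtn_eqF ex) -expr2 sqrtr_sqr ger0_norm ?rate_ge0 //.
  have := ler_wpM2r (sqr_ge0 (w x)) (dle x ex); rewrite /q /Defs.ratio; lra.
rewrite sumrB.
have -> : \sum_x \sum_y w x * Mmx g H x y eta * w y =
    \sum_x w x * Mmx g H x x eta * w x
    + \sum_x \sum_(y | y != x) w x * Mmx g H x y eta * w y.
  by rewrite -big_split; apply: eq_bigr => x _; rewrite (bigD1 x).
rewrite lerD2l.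
apply: (@le_trans _ _ (\sum_x \sum_(y | y != x)
    - (q x * e x y + q y * e x y) / 2)); last first.
  by apply: ler_sum => x _; apply: ler_sum => y; exact: offdiag.
under [leRHS]eq_bigr do rewrite -mulr_suml sumrN big_split /=.
rewrite -mulr_suml sumrN big_split /= sumq.
lra.
Qed.

End dynamics.

(** * Both lower bounds on the gap *)

Theorem theorem4p2 (R : realType) (V : finType) (N : nat)
    (g : V -> nat -> R) (H : config V -> R)
    (hN : (1 <= N)%N)
    (hg0 : forall x : V, g x 0%N = 0)
    (hg1 : forall (x : V) (k : nat), (1 <= k)%N -> 1 <= g x k) :
  (forall delta : R, 0 < delta ->
     (forall (eta : config V) (w : V -> R),
        SN V N eta -> (forall x, eta x = 0%N -> w x = 0) ->
        delta * \sum_x w x ^+ 2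
          <= \sum_x \sum_y w x * Mmx g H x y eta * w y) ->
     (delta%:E <= gap g H N)%E)
  /\
  (ereal_inf
     [set ereal_inf
            [set (#|V|%:R * rate g H x eta *
                  (1 - rate g H x (remove x eta) / rate g H x eta
                     - eps H x eta))%:E
            | eta in [set eta : config V | SN V N eta /\ (0 < eta x)%N]]
     | x in [set: V]]
   <= gap g H N)%E.
Proof.
case: N hN => [//|M] _.
have gap_ge delta : 0 < delta ->
    (forall (eta : config V) (w : V -> R),
       SN V M.+1 eta -> (forall x, eta x = 0%N -> w x = 0) ->
       delta * \sum_x w x ^+ 2 <= \sum_x \sum_y w x * Mmx g H x y eta * w y) ->
    (delta%:E <= gap g H M.+1)%E.
  move=> delta0 Mge; apply: ereal_sup_ubound; exists delta => //.
  split; first exact: ltW.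
  (* If [V] is empty, no configuration has [M + 1] particles and both sides of the inequality are
     0. *)
  have [v _|V0] := pickP V; first exact: (poincare_lower_bound _ _ v).
  have levels0 : levels V M.+1 = [::].
    case: levels (@mem_levels V M.+1) => // eta s /(_ eta).
    by rewrite mem_head big_pred0.
  by move=> f; rewrite !meanE levels0 !big_nil !mulr0 expr0n subrr mulr0 oppr0.
split=> //; set m := ereal_inf _.
have m_le delta : 0 < delta -> (delta%:E <= m)%E -> (delta%:E <= gap g H M.+1)%E.
  move=> delta0 le_m; apply: gap_ge => // eta w etaN w0.
  apply: Mmx_diag_dominant => // x ex; rewrite -lee_fin; apply: le_trans le_m _.
  apply: le_trans (ereal_inf_lbound _) _; first by exists x.
  by apply: ereal_inf_lbound; exists eta.
case: m m_le => [r| |] m_le.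
- have [r0|r0] := ltP 0 r; first exact: m_le.
  apply: (@le_trans _ _ 0%E); first by rewrite lee_fin.
  by apply: ereal_sup_ubound; exists 0 => //; split=> //; exact: poincare0.
(* The infimum is infinite only for empty [V]; then every positive real bounds the gap from
   below. *)
- suff -> : gap g H M.+1 = +oo%E by [].
  by apply/eqyP => A A0; rewrite m_le ?leey.
- exact: leNye.
Qed.
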